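(* Let $r$ be an odd integer. There is no $Q$-polynomial association scheme with Krein array $$\{2r^2-1,\ 2r^2-2,\ r^2+1;\ 1,\ 2,\ r^2-1\}.$$
   Context: A (symmetric) association scheme with $D$ classes is a pair $(X,\{R_i\}_{i=0}^D)$ where $X$ is a finite set and $R_0,\dots,R_D$ are non-empty subsets of $X\times X$ whose adjacency matrices $A_0,\dots,A_D$ satisfy: $A_0=I$, $\sum_i A_i=J$, $A_i^\top=A_i$, and $A_iA_j=\sum_k p_{ij}^kA_k$ for nonnegative integers $p_{ij}^k$. The real span of the $A_i$ has a basis of primitive idempotents $E_0=\frac{1}{|X|}J,E_1,\dots,E_D$, closed under entrywise product $\circ$; the Krein parameters $q_{ij}^k$ are defined by $E_i\circ E_j=\frac1{|X|}\sum_k q_{ij}^kE_k$. An ordering $E_1,\dots,E_D$ is $Q$-polynomial if $(q_{1j}^k)_{k,j=0}^D$ is tridiagonal with all superdiagonal and subdiagonal entries nonzero; then with $b_i^*=q_{1,i+1}^i$, $c_i^*=q_{1,i-1}^i$, the Krein array is $\{b_0^*,\dots,b_{D-1}^*;c_1^*,\dots,c_D^*\}$. A $Q$-polynomial association scheme with a given Krein array is one admitting a $Q$-polynomial ordering with that Krein array. *)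

(* Defs.v *)
From HB Require Import structures.
From mathcomp Require Import all_boot all_order all_algebra.
From mathcomp Require Import reals.

Set Implicit Arguments.
Unset Strict Implicit.
Unset Printing Implicit Defensive.

Import Order.TTheory GRing.Theory Num.Theory.
Local Open Scope ring_scope.

Section AssociationSchemes.

Variables (R : realType) (X : finType).

(* Matrices with rows and columns labelled by X are indexed by 'I_#|X| via
   enum_val. *)
Definition adjmx (S : {set X * X}) : 'M[R]_#|X| :=
  \matrix_(x, y) ((enum_val x, enum_val y) \in S)%:R.

Definition hadamard (M N : 'M[R]_#|X|) : 'M[R]_#|X| := map2_mx *%R M N.

Variable D : nat.

Definition association_scheme (Rel : 'I_D.+1 -> {set X * X}) : Prop :=
  [/\ forall i, Rel i != set0,
      adjmx (Rel ord0) = 1%:M,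
      \sum_i adjmx (Rel i) = const_mx 1,
      forall i, (adjmx (Rel i))^T = adjmx (Rel i)
    & exists p : 'I_D.+1 -> 'I_D.+1 -> 'I_D.+1 -> nat, forall i j,
        adjmx (Rel i) *m adjmx (Rel j) = \sum_k (p i j k)%:R *: adjmx (Rel k)].

Definition bose_mesner (Rel : 'I_D.+1 -> {set X * X}) : {vspace 'M[R]_#|X|} :=
  <<[seq adjmx (Rel i) | i : 'I_D.+1]>>%VS.

Definition idempotent_in (U : {vspace 'M[R]_#|X|}) (e : 'M[R]_#|X|) : Prop :=
  e \in U /\ e *m e = e.

Definition primitive_idempotent_in
    (U : {vspace 'M[R]_#|X|}) (e : 'M[R]_#|X|) : Prop :=
  [/\ idempotent_in U e, e != 0
    & forall f g, idempotent_in U f -> idempotent_in U g ->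
        f *m g = 0 -> g *m f = 0 -> e = f + g -> f = 0 \/ g = 0].

Definition idempotent_ordering (Rel : 'I_D.+1 -> {set X * X})
    (E : 'I_D.+1 -> 'M[R]_#|X|) : Prop :=
  [/\ forall i, primitive_idempotent_in (bose_mesner Rel) (E i),
      basis_of (bose_mesner Rel) [seq E i | i : 'I_D.+1]
    & E ord0 = #|X|%:R^-1 *: const_mx 1].

(* q i j k stands for q_{ij}^k; as the E k form a basis, q is determined by
   E. *)
Definition krein_parameters (E : 'I_D.+1 -> 'M[R]_#|X|)
    (q : 'I_D.+1 -> 'I_D.+1 -> 'I_D.+1 -> R) : Prop :=
  forall i j,
    hadamard (E i) (E j) = #|X|%:R^-1 *: \sum_k q i j k *: E k.

(* inord n : 'I_D.+1 has value n only if n <= D, so inord 1 needs 0 < D. *)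
Definition krein_mx (q : 'I_D.+1 -> 'I_D.+1 -> 'I_D.+1 -> R) : 'M[R]_D.+1 :=
  \matrix_(k, j) q (inord 1) j k.

Definition q_polynomial (q : 'I_D.+1 -> 'I_D.+1 -> 'I_D.+1 -> R) : Prop :=
  [/\ (0 < D)%N,
      forall k j : 'I_D.+1, (k.+1 < j)%N || (j.+1 < k)%N -> krein_mx q k j = 0
    & forall k j : 'I_D.+1,
        (j == k.+1 :> nat) || (k == j.+1 :> nat) -> krein_mx q k j != 0].

Definition krein_array (q : 'I_D.+1 -> 'I_D.+1 -> 'I_D.+1 -> R) :
    seq R * seq R :=
  ([seq q (inord 1) (inord i.+1) (inord i) | i <- iota 0 D],
   [seq q (inord 1) (inord i.-1) (inord i) | i <- iota 1 D]).

Definition q_polynomial_scheme_with_krein_array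
    (Rel : 'I_D.+1 -> {set X * X}) (bc : seq R * seq R) : Prop :=
  association_scheme Rel /\
  exists (E : 'I_D.+1 -> 'M[R]_#|X|)
         (q : 'I_D.+1 -> 'I_D.+1 -> 'I_D.+1 -> R),
    [/\ idempotent_ordering Rel E, krein_parameters E q,
        q_polynomial q & krein_array q = bc].

End AssociationSchemes.

(* Main.v *)
Require Import Defs.
From HB Require Import structures.
From mathcomp Require Import all_boot all_order all_algebra.
From mathcomp Require Import reals ring lra zify.

Set Implicit Arguments.
Unset Strict Implicit.
Unset Printing Implicit Defensive.

Import Order.TTheory GRing.Theory Num.Theory.
Local Open Scope ring_scope.

(** Put [t = r^2] and [G = |X| E_1]. The Krein array forces [|X| = 4 t^2], and
    the entries of [G] are [2 t - 1] on the diagonal and [-1], [-1 + 2 r],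
    [-1 - 2 r] off it, so [G = 2 r f - 1] for a symmetric integer matrix [f]
    with diagonal [r] and off-diagonal entries [0], [1], [-1]. As
    [q_11^1 = q_11^3 = 0], the triple products of [E_1, E_1, E_1] and
    [E_1, E_1, E_3] vanish (a sum of their squares is a multiple of the Krein
    parameter), which gives, for all [u], [v], [w],
      [sum_x f_ux f_vx f_wx   = t (f_uv + f_uw + f_vw) - r],
      [sum_x f_ux f_vx f_wx^2 = (t - 1) r f_uv + 2 t f_uw f_vw].
    The left-hand sides agree modulo 2, so for odd [r] every
    [f_uv + f_uw + f_vw] is odd. Since [sum_w f_uw^2 = 2 t^2] is too small for
    all entries to be nonzero, some [f_uv] vanishes; then exactly one of
    [f_uw], [f_vw] is nonzero for each [w], and summing
    [f_uw^2 + f_vw^2] over [w] yields [4 t^2 - 2 + 2 t = 4 t^2], i.e. [t = 1],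
    which contradicts [c_3^* = t - 1 <> 0]. *)

Lemma mem_span_codom (K : fieldType) (V : vectType K) (n : nat) (F : 'I_n -> V)
    (v : V) :
  v \in <<[seq F i | i : 'I_n]>>%VS -> exists c : 'I_n -> K, v = \sum_i c i *: F i.
Proof.
rewrite span_def big_image => /memv_sumP [vs vsP ->].
have /fin_all_exists [c cP] : forall i, exists k, vs i = k *: F i.
  by move=> i; apply/vlineP/vsP.
by exists c; apply: eq_bigr => i _; rewrite cP.
Qed.

(** * Vanishing of triple products of idempotents *)

Section KreinVanishing.

Variables (R : realType) (n : nat).
Implicit Types A B C : 'M[R]_n.

(** A symmetric idempotent is the Gram matrix of its own rows. After expanding the square into a
    double sum over [x] and [y], the sums over [u], [v] and [w] separate, and each collapses to an
    entry of [A], [B] or [C]. *)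
Lemma sum_sqr_triple_product A B C :
    A^T = A -> B^T = B -> C^T = C -> A *m A = A -> B *m B = B -> C *m C = C ->
  \sum_u \sum_v \sum_w (\sum_x A x u * B x v * C x w) ^+ 2
    = \sum_x \sum_y A x y * B x y * C x y.
Proof.
move=> sA sB sC iA iB iC.
have E (M : 'M[R]_n) x y : M^T = M -> M *m M = M -> M x y = \sum_u M x u * M y u.
  move=> sM iM; rewrite -{1}iM mxE; apply: eq_bigr => u _.
  by rewrite -{2}sM mxE.
transitivity (\sum_u \sum_v \sum_w \sum_x \sum_y
   (A x u * A y u) * (B x v * B y v) * (C x w * C y w)).
  do 3!(apply: eq_bigr => ? _).
  rewrite expr2 mulr_suml; apply: eq_bigr => x _; rewrite mulr_sumr.
  by apply: eq_bigr => y _; ring.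
(* The sums over [x] and [y] are pulled out past [w], [v] and [u] in turn. *)
under eq_bigr => u _.
  under eq_bigr => v _.
    rewrite exchange_big /=; under eq_bigr => x _ do rewrite exchange_big /=.
    over.
  rewrite exchange_big /=; under eq_bigr => x _ do rewrite exchange_big /=.
  over.
rewrite exchange_big /=; apply: eq_bigr => x _.
rewrite exchange_big /=; apply: eq_bigr => y _.
rewrite (E A) // (E B) // (E C) // -mulrA mulr_suml; apply: eq_bigr => u _.
rewrite mulr_suml mulr_sumr; apply: eq_bigr => v _.
by rewrite !mulr_sumr; apply: eq_bigr => w _; ring.
Qed.

Lemma triple_product_eq0 A B C :
    A^T = A -> B^T = B -> C^T = C -> A *m A = A -> B *m B = B -> C *m C = C ->
    \sum_x \sum_y A x y * B x y * C x y = 0 ->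
  forall u v w, \sum_x A x u * B x v * C x w = 0.
Proof.
move=> sA sB sC iA iB iC; rewrite -sum_sqr_triple_product // => /eqP.
have s0 u v : 0 <= \sum_w (\sum_x A x u * B x v * C x w) ^+ 2.
  by apply: sumr_ge0 => w _; apply: sqr_ge0.
rewrite psumr_eq0; last by move=> u _; apply: sumr_ge0 => v _; apply: s0.
move=> /allP H u v w; have /= := H u (mem_index_enum _).
rewrite psumr_eq0 // => /allP /(_ v (mem_index_enum _)) /=.
rewrite psumr_eq0; last by move=> ? _; apply: sqr_ge0.
by move=> /allP /(_ w (mem_index_enum _)) /=; rewrite sqrf_eq0 => /eqP.
Qed.

(** For symmetric [B] the sum is the trace of [A *m B]. *)
Lemma sum_mul_entries_eq0 A B :
  B^T = B -> A *m B = 0 -> \sum_x \sum_y A x y * B x y = 0.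
Proof.
move=> sB AB; apply: big1 => x _.
transitivity ((A *m B) x x); last by rewrite AB mxE.
by rewrite mxE; apply: eq_bigr => y _; rewrite -{1}sB mxE.
Qed.

End KreinVanishing.

(** * The Bose-Mesner algebra, its idempotents and the Krein parameters *)

Section BoseMesner.

Variables (R : realType) (X : finType) (D : nat) (Rel : 'I_D.+1 -> {set X * X}).
Hypothesis schemeRel : association_scheme R Rel.

Let A i := adjmx R (Rel i).
Let U := bose_mesner R Rel.

Lemma adjmx_mem i : A i \in U.
Proof. by apply/memv_span/image_f. Qed.

Lemma one_mem_bose_mesner : 1%:M \in U.
Proof. by case: schemeRel => _ <- _ _ _; apply: adjmx_mem. Qed.

Lemma bose_mesner_sym M : M \in U -> M^T = M.
Proof.
case: schemeRel => _ _ _ symA _ /mem_span_codom [c ->].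
by rewrite linear_sum; apply: eq_bigr => i _; rewrite linearZ /= symA.
Qed.

Lemma bose_mesner_mul M N : M \in U -> N \in U -> M *m N \in U.
Proof.
case: schemeRel => _ _ _ _ [p mulA].
move=> /mem_span_codom [c ->] /mem_span_codom [d ->].
rewrite mulmx_suml; apply: memv_suml => i _; rewrite mulmx_sumr.
apply: memv_suml => j _; rewrite -scalemxAl -scalemxAr mulA.
by do 2!apply: memvZ; apply: memv_suml => k _; apply/memvZ/adjmx_mem.
Qed.

Lemma bose_mesner_comm M N : M \in U -> N \in U -> M *m N = N *m M.
Proof.
move=> UM UN; rewrite -[LHS]bose_mesner_sym ?bose_mesner_mul // trmx_mul.
by rewrite !bose_mesner_sym.
Qed.

(** The identity already accounts for the whole diagonal of the all-ones matrix, and the remaining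
    nonnegative terms must vanish there. *)
Lemma adjmx_diag i x : A i x x = (i == ord0)%:R.
Proof.
case: schemeRel => _ A0 sumA _ _.
have A0x : A ord0 x x = 1 by rewrite /A A0 mxE eqxx.
case: eqVneq => [-> //|i0].
have := congr1 (fun M : 'M[R]_#|X| => M x x) sumA.
rewrite summxE mxE (bigD1 ord0) //= -/(A ord0) A0x => /(canRL (addKr _)).
rewrite addNr => /eqP; rewrite psumr_eq0; last by move=> j _; rewrite mxE ler0n.
by move=> /allP /(_ i (mem_index_enum _)); rewrite i0 /= => /eqP.
Qed.

Lemma bose_mesner_diag M x y : M \in U -> M x x = M y y.
Proof.
move=> /mem_span_codom [c ->]; rewrite !summxE; apply: eq_bigr => i _.
by have := adjmx_diag i x; have := adjmx_diag i y; rewrite /A !mxE => -> ->.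
Qed.

Lemma card_scheme_gt0 : (0 < #|X|)%N.
Proof.
case: schemeRel => Rn0 _ _ _ _; have /set0Pn [[x y] _] := Rn0 ord0.
by apply/card_gt0P; exists x.
Qed.

(** By commutativity [e *m f] and [e - e *m f] are orthogonal idempotents with sum [e], so
    primitivity kills one of them. *)
Lemma primitive_idempotent_absorb e f :
    primitive_idempotent_in U e -> idempotent_in U f ->
  e *m f = 0 \/ e *m f = e.
Proof.
move=> [[Ue ee] _ prim] [Uf ff].
have C := bose_mesner_comm Ue Uf.
have Uef := bose_mesner_mul Ue Uf.
have eef : e *m (e *m f) = e *m f by rewrite mulmxA ee.
have efe : e *m f *m e = e *m f by rewrite C -mulmxA ee.
have efef : e *m f *m (e *m f) = e *m f by rewrite mulmxA efe -mulmxA ff.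
have [||||||H] := prim (e *m f) (e - e *m f).
- by [].
- split; first by rewrite memvB.
  by rewrite mulmxBl !mulmxBr ee eef efe efef subrr subr0.
- by rewrite mulmxBr efe efef subrr.
- by rewrite mulmxBl eef efef subrr.
- by rewrite addrC subrK.
- by left.
- by right; apply/eqP; rewrite eq_sym -subr_eq0 H.
Qed.

Variable E : 'I_D.+1 -> 'M[R]_#|X|.
Hypothesis ordE : idempotent_ordering Rel E.

Lemma idempotent_ordering_mem i : E i \in U.
Proof. by case: ordE => /(_ i) [[]]. Qed.

Lemma idempotent_ordering_neq0 i : E i != 0.
Proof. by case: ordE => /(_ i) []. Qed.

Lemma idempotent_ordering_mul i j :
  E i *m E j = if i == j then E i else 0.
Proof.
case: ordE => primE /andP [_ /free_uniq uniqE] _.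
case: eqVneq => [<-|nij]; first by have [[]] := primE i.
have Cij : E i *m E j = E j *m E i.
  by apply: bose_mesner_comm; apply: idempotent_ordering_mem.
have idE k : idempotent_in U (E k) by have [] := primE k.
have [//|Ei] := primitive_idempotent_absorb (primE i) (idE j).
have [|Ej] := primitive_idempotent_absorb (primE j) (idE i).
  by rewrite Cij.
(* A nonzero product would equal both [E i] and [E j]; a free family has no repetitions. *)
have /injectiveP injE : injectiveb E by [].
by case/eqP: nij; apply: injE; rewrite -Ei Cij.
Qed.

Lemma idempotent_ordering_coef (c d : 'I_D.+1 -> R) :
  \sum_i c i *: E i = \sum_i d i *: E i -> c =1 d.
Proof.
have mulE (b : 'I_D.+1 -> R) k : (\sum_i b i *: E i) *m E k = b k *: E k.
  rewrite mulmx_suml (bigD1 k) //= -scalemxAl idempotent_ordering_mul eqxx.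
  rewrite big1 ?addr0 // => i nik.
  by rewrite -scalemxAl idempotent_ordering_mul (negPf nik) scaler0.
move=> eq_cd k; have /eqP := congr1 (mulmx^~ (E k)) eq_cd.
rewrite !mulE -subr_eq0 -scalerBl scaler_eq0.
by rewrite (negPf (idempotent_ordering_neq0 k)) orbF subr_eq0 => /eqP.
Qed.

Lemma idempotent_ordering_sum : \sum_i E i = 1%:M.
Proof.
have spanE : <<[seq E i | i : 'I_D.+1]>>%VS = U.
  by case: ordE => _ /span_basis.
have := one_mem_bose_mesner; rewrite -spanE => /mem_span_codom [c c1].
rewrite c1; apply: eq_bigr => j _.
have := congr1 (mulmx^~ (E j)) c1; rewrite mul1mx mulmx_suml (bigD1 j) //=.
rewrite -scalemxAl idempotent_ordering_mul eqxx big1 ?addr0 // => i nij.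
by rewrite -scalemxAl idempotent_ordering_mul (negPf nij) scaler0.
Qed.

Variable q : 'I_D.+1 -> 'I_D.+1 -> 'I_D.+1 -> R.
Hypothesis kreinE : krein_parameters E q.

Let nX : R := #|X|%:R.
Let nX_neq0 : nX != 0. Proof. by rewrite pnatr_eq0 -lt0n card_scheme_gt0. Qed.

Lemma hadamard_entry i j x y :
  (nX * E i x y) * (nX * E j x y) = \sum_k q i j k * (nX * E k x y).
Proof.
have := congr1 (fun M : 'M[R]_#|X| => M x y) (kreinE i j).
rewrite !mxE summxE => H.
rewrite mulrACA H -/nX mulrA mulfK // mulr_sumr; apply: eq_bigr => k _.
by rewrite mxE mulrCA.
Qed.

(** Scaled by [nX], [E ord0] is the all-ones matrix, the unit for the entrywise product. *)
Lemma krein_ord0 i k : q i ord0 k = (k == i)%:R.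
Proof.
apply: (idempotent_ordering_coef (c := q i ord0) (d := fun k => (k == i)%:R)).
have -> : \sum_k q i ord0 k *: E k = nX *: hadamard (E i) (E ord0).
  by rewrite kreinE scalerA mulfV // scale1r.
rewrite (bigD1 i) //= eqxx scale1r big1 ?addr0; last first.
  by move=> j nji; rewrite (negPf nji) scale0r.
case: ordE => _ _ ->; apply/matrixP => x y; rewrite !mxE.
by rewrite mulr1 mulrCA mulfV ?mulr1.
Qed.

(* [nX * E i x x] is the multiplicity of [E i]. *)
Lemma krein_row_sum i k x : \sum_j q i j k = nX * E i x x.
Proof.
pose m := nX * E i x x.
apply: (idempotent_ordering_coef (c := fun k => \sum_j q i j k) (d := fun=> m)).
rewrite -scaler_sumr idempotent_ordering_sum.
transitivity (nX *: hadamard (E i) 1%:M).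
  rewrite -idempotent_ordering_sum.
  under eq_bigr => l _ do rewrite scaler_suml.
  rewrite exchange_big /=; apply/matrixP => y z.
  rewrite summxE !mxE summxE mulrA mulr_sumr; apply: eq_bigr => j _.
  rewrite summxE; apply: (mulfI nX_neq0).
  transitivity (nX * E i y z * (nX * E j y z)); last by ring.
  rewrite hadamard_entry mulr_sumr; apply: eq_bigr => l _.
  by rewrite mxE mulrCA.
apply/matrixP => y z; rewrite !mxE; case: eqVneq => [<-|_]; last by rewrite !mulr0.
by rewrite !mulr1 /m (bose_mesner_diag x y) // idempotent_ordering_mem.
Qed.

(** If [q i j k = 0], the entrywise product of [E i] and [E j] has no [E k] component, so its matrix
    product with [E k] is zero and the sum of squares of the triple products vanishes. *)
Lemma krein_triple_product_eq0 i j k :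
  q i j k = 0 -> forall u v w, \sum_x E i x u * E j x v * E k x w = 0.
Proof.
move=> qijk.
have UE := idempotent_ordering_mem.
have iE l : E l *m E l = E l by rewrite idempotent_ordering_mul eqxx.
apply: triple_product_eq0 => //; try exact: bose_mesner_sym.
rewrite -[RHS](@sum_mul_entries_eq0 _ _ (hadamard (E i) (E j)) (E k)).
- by apply: eq_bigr => x _; apply: eq_bigr => y _; rewrite mxE.
- exact: bose_mesner_sym.
rewrite kreinE -scalemxAl mulmx_suml big1 ?scaler0 // => l _.
rewrite -scalemxAl idempotent_ordering_mul.
by case: eqVneq => [->|_]; rewrite ?qijk ?scale0r ?scaler0.
Qed.

End BoseMesner.

(** * The parity contradiction for the integer matrix *)

Lemma sum_pred1 (K : pzSemiRingType) (I : finType) (u : I) :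
  \sum_w (w == u)%:R = 1 :> K.
Proof.
by rewrite (bigD1 u) //= eqxx big1 ?addr0 // => w /negPf ->.
Qed.

Section Parity.

Variables (I : finType) (r : int) (f : I -> I -> int).
Hypotheses (r_odd : odd `|r|%N) (r2_neq1 : r ^+ 2 != 1).
Hypothesis card_I : #|I|%:R = 4 * r ^+ 4 :> int.
Hypothesis f_sym : forall x y, f x y = f y x.
Hypothesis f_diag : forall x, f x x = r.
Hypothesis f_offdiag : forall x y, x != y -> [\/ f x y = 0, f x y = 1 | f x y = -1].
Hypothesis sum_f2 : forall u, \sum_x f u x ^+ 2 = 2 * r ^+ 4.
Hypothesis sum_fff : forall u v w,
  \sum_x f u x * f v x * f w x = r ^+ 2 * (f u v + f u w + f v w) - r.
Hypothesis sum_fff2 : forall u v w,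
  \sum_x f u x * f v x * f w x ^+ 2
    = (r ^+ 2 - 1) * r * f u v + 2 * r ^+ 2 * f u w * f v w.

Lemma odd_intE : exists s : int, r = 2 * s + 1.
Proof.
exists (r %/ 2)%Z; move: r_odd; lia.
Qed.

Lemma triple_parity u v w :
  exists k : int, f u v + f u w + f v w = 2 * k + 1.
Proof.
have [s rE] := odd_intE.
have dvd2 x : (2 %| f w x ^+ 2 - f w x)%Z.
  have [<-|/f_offdiag] := eqVneq w x; last by case=> ->.
  rewrite f_diag rE; apply/dvdzP; exists (s * (2 * s + 1)); ring.
have : (2 %| \sum_x f u x * f v x * f w x ^+ 2 - \sum_x f u x * f v x * f w x)%Z.
  by rewrite -sumrB; apply: rpred_sum => x _; rewrite -mulrBr dvdz_mull.
rewrite sum_fff sum_fff2 => /dvdzP [k kE].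
(* Here [m] is [(r ^+ 2 - 1) / 2], and the witness comes from solving [kE] for
   [f u v + f u w + f v w]. *)
rewrite rE in kE; pose m := 2 * s ^+ 2 + 2 * s.
exists (m * r * f u v + r ^+ 2 * f u w * f v w + s - k
        - m * (f u v + f u w + f v w)).
by rewrite rE /m; lia.
Qed.

Lemma triple_parity_absurd : False.
Proof.
have [s rE] := odd_intE.
have r2_gt1 : 1 < r ^+ 2 by move: r2_neq1; nia.
have r4E : r ^+ 4 = r ^+ 2 * r ^+ 2 by ring.
have /card_gt0P [u _] : (0 < #|I|)%N.
  by rewrite -(ltr_nat int) card_I r4E; nia.
have [v /andP [nvu /eqP fuv]|nz] := pickP (fun v => (v != u) && (f u v == 0)).
(* The correction terms account for the columns [w = u] and [w = v], where the value is [r ^+ 2]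
   instead of 1. *)
- have sqE w : f u w ^+ 2 + f v w ^+ 2
      = 1 + (r ^+ 2 - 1) * (w == u)%:R + (r ^+ 2 - 1) * (w == v)%:R.
    have [->|nwu] := eqVneq w u.
      by rewrite f_diag f_sym fuv eq_sym (negPf nvu) /=; ring.
    have [->|nwv] := eqVneq w v; first by rewrite f_diag fuv /=; ring.
    rewrite !mulr0 !addr0; have [k] := triple_parity u v w; rewrite fuv.
    rewrite eq_sym in nwu; rewrite eq_sym in nwv.
    by case: (f_offdiag nwu) (f_offdiag nwv) => -> [] ->; lia.
  have : \sum_w (f u w ^+ 2 + f v w ^+ 2) = 4 * r ^+ 4.
    by rewrite big_split /= !sum_f2; ring.
  rewrite (eq_bigr _ (fun w _ => sqE w)) !big_split /= -!mulr_sumr.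
  rewrite !sum_pred1 sumr_const card_I; lia.
(* With no zero in row [u], the squares would add up to [4 * r ^+ 4 + r ^+ 2 - 1], more than
   [2 * r ^+ 4]. *)
have sqE w : f u w ^+ 2 = 1 + (r ^+ 2 - 1) * (w == u)%:R.
  have [->|nwu] := eqVneq w u; first by rewrite f_diag /=; ring.
  have := nz w; rewrite nwu /=; rewrite eq_sym in nwu.
  by case: (f_offdiag nwu) => ->; rewrite mulr0 addr0.
have := sum_f2 u; rewrite (eq_bigr _ (fun w _ => sqE w)) big_split /=.
by rewrite -mulr_sumr sum_pred1 sumr_const card_I r4E; nia.
Qed.

End Parity.

(** * From the Krein array to the integer matrix *)

Lemma sum_ord4 (V : nmodType) (F : 'I_4 -> V) :
  \sum_i F i = F (inord 0) + F (inord 1) + F (inord 2) + F (inord 3).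
Proof.
rewrite !big_ord_recr big_ord0 /= add0r.
by do 3?[congr (_ + _)]; congr F; apply: val_inj; rewrite /= inordK.
Qed.

Lemma inord_eq (n i j : nat) : (i <= n)%N -> (j <= n)%N ->
  (inord i == inord j :> 'I_n.+1) = (i == j).
Proof. by move=> li lj; rewrite -val_eqE /= !inordK. Qed.

Section KreinArray.

Variables (R : realType) (r : int) (X : finType) (Rel : 'I_4 -> {set X * X}).
Variables (E : 'I_4 -> 'M[R]_#|X|) (q : 'I_4 -> 'I_4 -> 'I_4 -> R).
Hypotheses (r_odd : odd `|r|%N) (schemeRel : association_scheme R Rel).
Hypotheses (ordE : idempotent_ordering Rel E) (kreinE : krein_parameters E q).
Hypothesis q_poly : q_polynomial q.

Let rho : R := r%:~R.
Let t : R := rho ^+ 2.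
Let n : R := #|X|%:R.

Hypothesis arrayE :
  krein_array q = ([:: 2 * t - 1; 2 * t - 2; t + 1], [:: 1; 2; t - 1]).

(** This scaling removes the factor [1 / |X|] from the Krein relations. *)
Let G i x y : R := n * E (inord i) x y.

Let ord0E : ord0 = inord 0 :> 'I_4.
Proof. by apply: val_inj; rewrite /= inordK. Qed.

Let n_neq0 : n != 0.
Proof. by rewrite pnatr_eq0 -lt0n (card_scheme_gt0 schemeRel). Qed.

Let rho_neq0 : rho != 0.
Proof. by rewrite intr_eq0; move: r_odd; case: eqVneq => // ->. Qed.

Lemma krein_offdiag j k : (k.+1 < j <= 3)%N || (j.+1 < k <= 3)%N ->
  q (inord 1) (inord j) (inord k) = 0.
Proof.
move=> jk; case: q_poly => _ /(_ (inord k) (inord j)) + _.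
by rewrite mxE !inordK; [apply|..]; lia.
Qed.

Lemma krein_values :
  [/\ q (inord 1) (inord 1) (inord 0) = 2 * t - 1,
      q (inord 1) (inord 2) (inord 1) = 2 * t - 2,
      q (inord 1) (inord 3) (inord 2) = t + 1,
      q (inord 1) (inord 1) (inord 2) = 2
    & q (inord 1) (inord 2) (inord 3) = t - 1].
Proof. by move: arrayE => [? ? ? _ ? ?]. Qed.

Lemma t_neq1 : t != 1.
Proof.
have [_ _ _ _ q3] := krein_values.
case: q_poly => _ _ /(_ (inord 3) (inord 2)).
by rewrite !mxE !inordK // q3 subr_eq0 => /(_ isT).
Qed.

Lemma gram0 x y : G 0 x y = 1.
Proof. by case: ordE => _ _; rewrite /G -ord0E => ->; rewrite !mxE mulr1 mulfV. Qed.

Lemma gram_sym i x y : G i x y = G i y x.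
Proof.
rewrite /G -[in LHS](bose_mesner_sym schemeRel (idempotent_ordering_mem ordE _)).
by rewrite mxE.
Qed.

Lemma gram_sum x y : G 0 x y + G 1 x y + G 2 x y + G 3 x y = n * (x == y)%:R.
Proof.
rewrite -!mulrDr; congr (_ * _).
have := congr1 (fun M : 'M[R]_#|X| => M x y) (idempotent_ordering_sum schemeRel ordE).
by rewrite sum_ord4 !mxE.
Qed.

(** The bounds matter because [inord] sends every larger index to 0. *)
Lemma gram_mul i j u v : (i <= 3)%N -> (j <= 3)%N ->
  \sum_x G i u x * G j v x = if i == j then n * G i u v else 0.
Proof.
move=> li lj; have := idempotent_ordering_mul schemeRel ordE (inord i) (inord j).
move=> /(congr1 (fun M : 'M[R]_#|X| => n * n * M u v)).
rewrite inord_eq // mxE mulr_sumr => EE.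
transitivity (n * n * (if i == j then E (inord i) else 0) u v).
  rewrite -EE; apply: eq_bigr => x _.
  by rewrite [G j v x]gram_sym /G mulrACA.
by case: ifP => _; rewrite ?mxE ?mulr0 // /G mulrA.
Qed.

Lemma gram_hadamard j x y : G 1 x y * G j x y =
  q (inord 1) (inord j) (inord 0) * G 0 x y
  + q (inord 1) (inord j) (inord 1) * G 1 x y
  + q (inord 1) (inord j) (inord 2) * G 2 x y
  + q (inord 1) (inord j) (inord 3) * G 3 x y.
Proof. by rewrite /G (hadamard_entry schemeRel kreinE) sum_ord4. Qed.

Lemma gram_triple k : q (inord 1) (inord 1) (inord k) = 0 ->
  forall u v w, \sum_x G 1 u x * G 1 v x * G k w x = 0.
Proof.
move=> qk u v w.
transitivity (n ^+ 3 *
    \sum_x E (inord 1) x u * E (inord 1) x v * E (inord k) x w).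
  rewrite mulr_sumr; apply: eq_bigr => x _.
  by rewrite ![G _ _ x]gram_sym /G; ring.
by rewrite (krein_triple_product_eq0 schemeRel ordE kreinE qk) mulr0.
Qed.

(** All rows of the Krein matrix have the same sum, the multiplicity of [E (inord 1)]. Row 0 gives
    this multiplicity; rows 1 and 2 then give their diagonal entries. *)
Lemma krein_diag x :
  [/\ G 1 x x = 2 * t - 1, q (inord 1) (inord 1) (inord 1) = 0
    & q (inord 1) (inord 2) (inord 2) = t - 4].
Proof.
have [q0 q1 q2 q3 q4] := krein_values.
have rows k : q (inord 1) (inord 0) (inord k) + q (inord 1) (inord 1) (inord k)
    + q (inord 1) (inord 2) (inord k) + q (inord 1) (inord 3) (inord k) = G 1 x x.
  by rewrite /G -(krein_row_sum schemeRel ordE kreinE _ (inord k)) sum_ord4.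
have := rows 0; have := rows 1; have := rows 2.
rewrite -!ord0E !(krein_ord0 schemeRel ordE kreinE) !ord0E !inord_eq //=.
rewrite q0 q1 q2 q3 (@krein_offdiag 2 0) // (@krein_offdiag 3 0) //
  (@krein_offdiag 3 1) //.
by move=> r2 r1 r0; split; lra.
Qed.

Lemma gram_recurrence x y :
  G 1 x y ^+ 2 = 2 * t - 1 + 2 * G 2 x y
  /\ G 1 x y * G 2 x y
       = (2 * t - 2) * G 1 x y + (t - 4) * G 2 x y + (t - 1) * G 3 x y.
Proof.
have [q0 q1 q2 q3 q4] := krein_values; have [_ q5 q6] := krein_diag x.
split.
  by rewrite expr2 gram_hadamard q0 q5 q3 krein_offdiag // gram0; ring.
by rewrite gram_hadamard q1 q6 q4 krein_offdiag //; ring.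
Qed.

(** On the diagonal the recurrence determines all the multiplicities, whose sum is [n]. Solving for
    the last one divides by [t - 1]. *)
Lemma card_scheme : n = 4 * t ^+ 2.
Proof.
have /card_gt0P [x0 _] := card_scheme_gt0 schemeRel.
pose x := enum_rank x0.
have [e1 e2] := gram_recurrence x x; have [d _ _] := krein_diag x.
have := gram_sum x x; rewrite eqxx mulr1 gram0 => <-.
rewrite d in e1 e2 *.
have e3 : G 2 x x = (2 * t - 1) * (t - 1) by lra.
have t1 : t - 1 != 0 by rewrite subr_eq0 t_neq1.
have -> : G 3 x x = (2 * t - 1) * (t + 1).
  by apply: (mulfI t1); rewrite e3 in e2; lra.
by rewrite e3; ring.
Qed.

Let gram1_entries : exists f : 'I_#|X| -> 'I_#|X| -> int, forall x y,
  G 1 x y = 2 * rho * (f x y)%:~R - 1 /\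
  if x == y then f x y = r else [\/ f x y = 0, f x y = 1 | f x y = -1].
Proof.
suff key x y : exists k : int, G 1 x y = 2 * rho * k%:~R - 1 /\
    if x == y then k = r else [\/ k = 0, k = 1 | k = -1].
  exact: fin_all_exists (fun x => fin_all_exists (key x)).
case: eqVneq => [<-|nxy].
  by exists r; have [-> _ _] := krein_diag x; split=> //; rewrite /t; ring.
have [e1 e2] := gram_recurrence x y; have := gram_sum x y.
rewrite (negPf nxy) mulr0 gram0 => e3.
(* The sum of the G i vanishes off the diagonal; substituting the recurrence
   gives the cubic with roots -1, -1 + 2 rho and -1 - 2 rho. *)
have : (G 1 x y + 1) * (G 1 x y + 1 - 2 * rho) * (G 1 x y + 1 + 2 * rho) = 0.
  set g := G 1 x y in e1 e2 e3 *.
  have e4 : G 2 x y = (g ^+ 2 - (2 * t - 1)) / 2 by lra.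
  have e5 : G 3 x y = - 1 - g - G 2 x y by lra.
  rewrite e5 e4 in e2.
  have -> : (g + 1) * (g + 1 - 2 * rho) * (g + 1 + 2 * rho)
          = (g + 1) * ((g + 1) ^+ 2 - 4 * t) by rewrite /t; ring.
  lra.
move=> /eqP; rewrite !mulf_eq0 => /orP [/orP [] |] /eqP e.
- by exists 0; split; [lra | constructor 1].
- by exists 1; split; [lra | constructor 2].
- by exists (-1); split; [rewrite mulrN1z; lra | constructor 3].
Qed.

Lemma krein_array_absurd : False.
Proof.
have [f fP] := gram1_entries.
pose F x y : R := (f x y)%:~R.
have GF x y : G 1 x y = 2 * rho * F x y - 1 by have [] := fP x y.
have FG x y : F x y = (G 1 x y + 1) / (2 * rho).
  by rewrite GF; field.
have t2 : rho ^+ 4 = t ^+ 2 by rewrite /t; ring.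
have nE := card_scheme.
have [q0 q1 q2 q3 q4] := krein_values.
have sum0 i u : (0 < i <= 3)%N -> \sum_x G i u x = 0.
  move=> li; under eq_bigr => x _ do rewrite -[G i u x]mulr1 -(gram0 u x).
  by rewrite gram_mul; [case: i li | lia |].
(* Since [G 1] is [n] times an idempotent and has zero row sums, the sum is
   [n * (G 1 u v + 1) / (4 * t)]. *)
have sumFF u v : \sum_x F u x * F v x = 2 * rho ^+ 3 * F u v.
  under eq_bigr => x _.
    rewrite !FG.
    have -> : (G 1 u x + 1) / (2 * rho) * ((G 1 v x + 1) / (2 * rho))
       = (4 * t)^-1 * (G 1 u x * G 1 v x + G 1 u x + G 1 v x + 1).
      by rewrite /t; field.
    over.
  rewrite -mulr_sumr !big_split /= gram_mul //= !sum0 // sumr_const card_ord.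
  by rewrite -/n nE GF /t; field.
(* The cubic term vanishes because [q_11^3 = 0], the others by orthogonality and zero row sums. *)
have sumFFG3 u v w : \sum_x F u x * F v x * G 3 w x = 0.
  under eq_bigr => x _.
    rewrite !FG.
    have -> : (G 1 u x + 1) / (2 * rho) * ((G 1 v x + 1) / (2 * rho)) * G 3 w x
       = (4 * t)^-1 * (G 1 u x * G 1 v x * G 3 w x + G 1 u x * G 3 w x
         + G 1 v x * G 3 w x + G 3 w x).
      by rewrite /t; field.
    over.
  rewrite -mulr_sumr !big_split /= gram_triple ?krein_offdiag //.
  by rewrite !gram_mul //= sum0 // !addr0 mulr0.
(* By the recurrence [(G 1 x y + 1) ^+ 2] is affine in [G 1 x y + G 2 x y], which [gram_sum] trades
   for [G 3 x y]. This brings the sums with a squared factor down to [sumFF] and [sumFFG3]. *)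
have G3F x y : 2 * t * F x y ^+ 2 = t - 1 - G 3 x y + n * (x == y)%:R.
  have [e1 _] := gram_recurrence x y.
  rewrite -gram_sum gram0 GF.
  have -> : G 2 x y = (G 1 x y ^+ 2 - (2 * t - 1)) / 2 by lra.
  by rewrite GF /t; field.
have t_neq0 : t != 0 by rewrite sqrf_eq0.
apply: (@triple_parity_absurd _ r f r_odd).
- apply: contraNneq t_neq1 => r2.
  by rewrite /t /rho -rmorphXn /= r2.
- apply: (@intr_inj R); rewrite card_ord rmorph_nat -/n nE.
  by rewrite rmorphM rmorphXn /= -/rho t2.
- move=> x y; apply: (@intr_inj R); apply: (mulfI (x := 2 * rho)).
    by rewrite mulf_neq0 // pnatr_eq0.
  by apply: (addIr (-1)); rewrite -!/(F _ _) -!GF gram_sym.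
- by move=> x; have [_] := fP x x; rewrite eqxx.
- by move=> x y nxy; have [_] := fP x y; rewrite (negPf nxy).
- move=> u; apply: (@intr_inj R); rewrite rmorph_sum /= rmorphM rmorphXn /=.
  under eq_bigr => x _ do rewrite rmorphXn expr2 /= -/(F u x).
  have [_] := fP u u; rewrite sumFF eqxx /F => ->.
  by rewrite -/rho; ring.
- move=> u v w; apply: (@intr_inj R); rewrite rmorph_sum /=.
  under eq_bigr => x _.
    rewrite !rmorphM /= -!/(F _ _) !FG.
    have -> : (G 1 u x + 1) / (2 * rho) * ((G 1 v x + 1) / (2 * rho))
         * ((G 1 w x + 1) / (2 * rho))
       = (8 * rho ^+ 3)^-1 * (G 1 u x * G 1 v x * G 1 w x + G 1 u x * G 1 v x
         + G 1 u x * G 1 w x + G 1 v x * G 1 w x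
         + G 1 u x + G 1 v x + G 1 w x + 1) by field.
    over.
  (* The cubic term of the expansion vanishes because [q_11^1 = 0]. *)
  have [_ q5 _] := krein_diag u.
  rewrite -mulr_sumr !big_split /= gram_triple // !gram_mul //= !sum0 //.
  rewrite sumr_const card_ord -/n nE !GF.
  rewrite rmorphB rmorphM rmorphXn /= !rmorphD /= -!/(F _ _) -/rho /t.
  by field.
move=> u v w; apply: (@intr_inj R); rewrite rmorph_sum /=.
apply: (mulfI (x := 2 * t)); first by rewrite mulf_neq0 // pnatr_eq0.
rewrite mulr_sumr.
under eq_bigr => x _.
  rewrite 2!rmorphM rmorphXn /= -!/(F _ _) mulrCA G3F.
  have -> : F u x * F v x * (t - 1 - G 3 w x + n * (w == x)%:R)
     = (t - 1) * (F u x * F v x) + - (F u x * F v x * G 3 w x)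
       + n * (F u x * F v x * (w == x)%:R) by ring.
  over.
rewrite !big_split /= sumrN -!mulr_sumr sumFFG3 sumFF.
rewrite (bigD1 w) //= eqxx big1 ?addr0; last first.
  by move=> x; rewrite eq_sym => /negPf ->; rewrite mulr0.
rewrite nE rmorphD !rmorphM rmorphB rmorphXn /= -!/(F _ _) -/rho /t.
by ring.
Qed.

End KreinArray.

Theorem theorem4p8 (R : realType) (r : int) (r_odd : odd `|r|%N) :
  ~ exists (X : finType) (D : nat) (Rel : 'I_D.+1 -> {set X * X}),
      q_polynomial_scheme_with_krein_array Rel
        ([:: 2 * r%:~R ^+ 2 - 1; 2 * r%:~R ^+ 2 - 2; r%:~R ^+ 2 + 1] : seq R,
         [:: 1; 2; r%:~R ^+ 2 - 1] : seq R).
Proof.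
move=> [X [D [Rel [schemeRel [E [q [ordE kreinE q_poly arrayE]]]]]]].
(* The length of the array determines [D]. *)
have D3 : D = 3%N.
  by have [/(congr1 size) + _] := arrayE; rewrite size_map size_iota.
subst D; exact: (krein_array_absurd r_odd schemeRel ordE kreinE q_poly arrayE).
Qed.
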